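(* For an odd prime $p$ and positive integers $t,s$ with $p\nmid s$, put $r=p^t$, $q=r^s$, let $\eta$ be the quadratic multiplicative character of $\mathbb{F}_r$ (with $\eta(0)=0$), $D=\{x\in\mathbb{F}_q^*:\eta(\mathrm{Tr}_{q/r}(x+1))=-\eta(s)\}$ (with $s$ regarded as an element of $\mathbb{F}_p\subseteq\mathbb{F}_r$), $K=\#D$, $E$ the set of all $N=q-1$ multiplicative characters of $\mathbb{F}_q^*$, and $\mathcal{C}(D;E)=\{\mathbf{c}_\varphi=\frac{1}{\sqrt K}(\varphi(x))_{x\in D}:\varphi\in E\}$. Let $I_{max}(\mathcal{C}(D;E))=\max_{\varphi\neq\varphi'}|\mathbf{c}_\varphi\mathbf{c}_{\varphi'}^H|$ and let $I_W=\sqrt{\frac{N-K}{(N-1)K}}$ be the Welch bound. Then $\frac{I_{max}(\mathcal{C}(D;E))}{I_W}\to 1$ as $r\to\infty$; that is, for every sequence of such parameter triples $(p,t,s)$ for which $r=p^t\to\infty$, the ratio $I_{max}(\mathcal{C}(D;E))/I_W$ tends to $1$.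
   Context: $\mathrm{Tr}_{q/r}$ denotes the trace map from $\mathbb{F}_q$ to $\mathbb{F}_r$; $\mathbf{c}^H$ is the conjugate transpose. A multiplicative character of $\mathbb{F}_q^*$ is a group homomorphism $\mathbb{F}_q^*\to\mathbb{C}^*$. *)

(* Defs.v *)
From HB Require Import structures.
From mathcomp Require Import all_boot all_order all_algebra all_fingroup all_field.
Set Implicit Arguments. Unset Strict Implicit. Unset Printing Implicit Defensive.
Import Order.TTheory GRing.Theory Num.Theory.
Local Open Scope ring_scope.

Definition trace_qr (F : finFieldType) (r s : nat) (x : F) : F :=
  \sum_(i < s) x ^+ (r ^ i).

(* Quadratic character of the subfield F_r = {z in F | z^r = z}, eta(0) = 0,
   evaluated at y (meaningful for y in F_r). *)
Definition quad_char (F : finFieldType) (r : nat) (y : F) : algC :=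
  if y == 0 then 0
  else if [exists z : F, (z ^+ r == z) && (z ^+ 2 == y)] then 1 else -1.

Definition D_set (F : finFieldType) (r s : nat) : {set {unit F}} :=
  [set u : {unit F} |
     quad_char r (trace_qr r s (val u + 1)) == - quad_char r (s%:R : F)].

Definition is_mult_char (F : finFieldType) (phi : {unit F} -> algC) : Prop :=
  (forall u v : {unit F}, phi (u * v)%g = phi u * phi v) /\
  (forall u : {unit F}, phi u != 0).

Definition corr (F : finFieldType) (r s : nat) (phi psi : {unit F} -> algC) : algC :=
  let K : algC := (#|D_set F r s|)%:R in
  `| \sum_(u in D_set F r s) (phi u / sqrtC K) * (psi u / sqrtC K)^* |.

Definition Imax_spec (F : finFieldType) (r s : nat) (M : algC) : Prop :=
  (exists phi psi : {unit F} -> algC,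
      [/\ is_mult_char phi, is_mult_char psi, (exists u, phi u != psi u)
        & corr r s phi psi = M]) /\
  (forall phi psi : {unit F} -> algC,
      is_mult_char phi -> is_mult_char psi -> (exists u, phi u != psi u) ->
      corr r s phi psi <= M).

Definition welch_bound (F : finFieldType) (r s : nat) : algC :=
  let N : algC := (#|F| - 1)%:R in
  let K : algC := (#|D_set F r s|)%:R in
  sqrtC ((N - K) / ((N - 1) * K)).

(* Main.v *)
(** Write [F_r] for the fixed points of [x |-> x ^+ r] (the set [A] of the
  scripts), [Tr] for the trace onto [F_r], [q = #|F|], [eta] for the quadratic
  character of [F_r], and let [w a] be [1] if [eta (a + s) = - eta s] and [0]
  otherwise, so that the character sum of [chi] over [D] is
  [W = sum_x chi x * w (Tr x)].  Substituting [x = u y] in [|W|^2] leaves, for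
  each [u], a sum over [y] of [w (Tr (u y)) * w (Tr y)]; for [u] outside [F_r]
  the pair [(Tr (u y), Tr y)] is uniform on [F_r x F_r], hence
  [|W|^2 = q/r |V|^2 - q/r^2 m^2 sum_(a in F_r) chi a] with
  [V = sum_(a in F_r) chi a * w a] and [m = sum_(a in F_r) w a = (r - 1)/2].
  Up to a term of modulus [1], [2 V] is a Jacobi sum over [F_r], whose modulus
  is at most [sqrt r].  This yields [4 |W|^2 <= q/r (1 + sqrt r)^2] for every
  nontrivial [chi], and therefore
  [(I_max / I_W)^2 <= (1 + sqrt r)^2 / (r - 1)].  Conversely
  [I_W <= I_max] by averaging [|W|^2] over all characters. *)
Require Import Defs.
From HB Require Import structures.
From mathcomp Require Import all_boot all_order all_algebra all_fingroup all_solvable all_field all_character.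
From mathcomp Require Import ring zify.
Set Implicit Arguments. Unset Strict Implicit. Unset Printing Implicit Defensive.
Import Order.TTheory GRing.Theory Num.Theory.
Local Open Scope ring_scope.

(** * Primitive roots and counting along fibres *)

Lemma primitive_element (F : finFieldType) :
  exists g : F, (forall x : F, x != 0 -> exists i : nat, x = g ^+ i) /\
    (forall n : nat, (g ^+ n == 1) = (#|F|.-1 %| n)%N).
Proof.
have /cyclicP [g defg] := field_unit_group_cyclic [set: {unit F}]%G.
have valX (n : nat) : val (g ^+ n)%g = val g ^+ n.
  by elim: n => // n IHn; rewrite expgS exprS -IHn.
exists (val g); split=> [x x0|n].
  have ux : x \is a GRing.unit by rewrite unitfE.
  have : FinRing.Unit ux \in <[g]>%g by rewrite -defg inE.
  by move/cycleP => [i] /(congr1 val) /=; rewrite valX => xg; exists i.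
have -> : #|F|.-1 = #[g]%g by rewrite -card_finField_unit orderE -defg.
by rewrite order_dvdn -valX -(inj_eq val_inj).
Qed.

(** Each nonempty fibre of [L] is a coset of [K], so every point of [B] is hit exactly [#|K|] times.
    This serves both for the trace and for the pair of traces of [u * x] and [x]. *)
Lemma sum_fibres (T : finZmodType) (V : finType) (L : T -> V) (K : {set T})
    (B : {pred V}) (f : V -> algC) :
  (forall x y, (L x == L y) = (x - y \in K)) -> (forall x, L x \in B) ->
  (forall b, b \in B -> exists x, L x = b) ->
  \sum_x f (L x) = #|K|%:R * \sum_(b in B) f b.
Proof.
move=> LK LB Lsurj; rewrite (partition_big L (mem B)) //= mulr_sumr.
apply: eq_bigr => b /Lsurj [x0 Lx0].
rewrite (eq_bigr (fun=> f b)) => [|x /eqP -> //].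
rewrite sumr_const mulr_natl; congr (_ *+ _).
rewrite -(card_imset (mem K) (addIr x0)); apply: eq_card => x.
rewrite -Lx0 [LHS]LK; apply/idP/imsetP => [Kx|[y Ky ->]]; last by rewrite addrK.
by exists (x - x0); rewrite ?subrK.
Qed.

(** * Multiplicative characters extended by zero to the whole field *)

Definition field_char (F : finFieldType) (chi : F -> algC) :=
  [/\ chi 0 = 0, chi 1 = 1 & {morph chi : x y / x * y}].

Section FieldChar.
Variables (F : finFieldType) (chi : F -> algC).
Hypothesis chiP : field_char chi.

Lemma field_charX n : {morph chi : x / x ^+ n}.
Proof.
case: chiP => _ chi1 chiM x.
by elim: n => [|n IHn]; rewrite ?expr0 // !exprS chiM IHn.
Qed.

Lemma norm_field_char x : x != 0 -> `|chi x| = 1.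
Proof.
move=> x0; have q_gt1 : (1 < #|F|)%N := finNzRing_gt1 F.
have : chi x ^+ #|F|.-1 = 1.
  rewrite -field_charX; case: chiP => _ <- _; congr chi; apply: (mulfI x0).
  by rewrite -exprS prednK ?(ltnW q_gt1) // expf_card mulr1.
move/(congr1 Num.norm); rewrite normrX normr1 => /eqP.
by rewrite pexpr_eq1 // -?subn1 ?subn_gt0 // => /eqP.
Qed.

Lemma field_char_mulconj x : x != 0 -> chi x * (chi x)^* = 1.
Proof. by move=> x0; rewrite -normCK norm_field_char // expr1n. Qed.

End FieldChar.

(** * Character sums over the fixed points of a power map *)

Section FixedField.
Variables (F : finFieldType) (r : nat).

(** Keeping the subfield as a predicate on [F] avoids a second field type, and the choice [r = #|F|]
    gives all of [F], so the lemmas below apply to sums over the field and over the subfield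
    alike. *)
Definition fixed_set : {pred F} := [pred x | x ^+ r == x].
Local Notation A := fixed_set.

Lemma fixed_setM x y : x \in A -> y \in A -> x * y \in A.
Proof. by rewrite !inE exprMn => /eqP -> /eqP ->. Qed.

Lemma fixed_setV x : x \in A -> x^-1 \in A.
Proof. by rewrite !inE exprVn => /eqP ->. Qed.

Lemma fixed_setMr x y : y != 0 -> y \in A -> (x * y \in A) = (x \in A).
Proof.
move=> y0 yA; apply/idP/idP => [|xA]; last exact: fixed_setM.
by move/fixed_setM => /(_ _ (fixed_setV yA)); rewrite mulfK.
Qed.

Lemma sum_fixed_dilation (R : nmodType) (y : F) (f : F -> R) : y != 0 -> y \in A ->
  \sum_(x in A) f (x * y) = \sum_(x in A) f x.
Proof.
move=> y0 yA; rewrite [RHS](reindex_inj (mulIf y0)) /=.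
by apply: eq_bigl => x; rewrite fixed_setMr.
Qed.

(** Expand the square into a double sum and, for each nonzero [y], put [x = u * y]: the factor
    [chi (u * y) * (chi y)^*] collapses to [chi u]. *)
Lemma sqr_norm_char_sum (chi f : F -> algC) : field_char chi ->
  `|\sum_(x in A) chi x * f x| ^+ 2 =
  \sum_(u in A) chi u * \sum_(y in A | y != 0) f (u * y) * (f y)^*.
Proof.
move=> chiP; case: (chiP) => chi0 _ chiM.
rewrite normCK rmorph_sum mulr_sumr.
under [RHS]eq_bigr do rewrite mulr_sumr.
rewrite [RHS]exchange_big /= (bigID (fun y => y == 0)) /= big1 ?add0r; last first.
  by move=> y /andP [_ /eqP ->]; rewrite chi0 mul0r conjC0 mulr0.
apply: eq_bigr => y /andP [yA y0].
rewrite mulr_suml -(sum_fixed_dilation _ y0 yA).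
apply: eq_bigr => u uA; rewrite chiM rmorphM.
rewrite -[RHS]mulr1 -(field_char_mulconj chiP y0).
by ring.
Qed.

(** If [f c] differs from 1 for some nonzero [c], dilation by [c] preserves the sum and also
    multiplies it by [f c], which forces it to vanish. *)
Lemma mult_fun_sum (f : F -> algC) : {in A &, {morph f : x y / x * y}} ->
  \sum_(x in A) f x = 0 \/ forall x, x \in A -> x != 0 -> f x = 1.
Proof.
move=> fM.
case: (boolP [forall (x | (x \in A) && (x != 0)), f x == 1]) => [/forall_inP H|].
  by right=> x xA x0; apply/eqP/H/andP.
case/forall_inPn => c /andP [cA c0] cn1; left.
have := sum_fixed_dilation f c0 cA.
rewrite (eq_bigr (fun x => f x * f c)) => [|x xA]; last exact: fM.
rewrite -mulr_suml => /eqP; rewrite -[X in _ == X]mulr1 -subr_eq0 -mulrBr mulf_eq0.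
by rewrite subr_eq0 (negPf cn1) orbF => /eqP.
Qed.

End FixedField.

(** The arithmetic of the final comparison, with [x] for r, [k] for the size of D and [M] for the
    maximal correlation; [k * M] is then the modulus of a character sum over D. The two last
    hypotheses are the averaging bound and the Jacobi sum bound. *)
Lemma welch_ratio_estimate (q x k B M : algC) : 3 <= x -> x <= q ->
  k = q * (x - 1) / (2 * x) -> 0 <= M -> 0 <= B ->
  (q - 1) * k - k ^+ 2 <= (q - 1 - 1) * (k * M) ^+ 2 ->
  (2 * (k * M)) ^+ 2 <= q / x * B ->
  let w := sqrtC ((q - 1 - k) / ((q - 1 - 1) * k)) in
  1 <= M / w /\ (M / w) ^+ 2 <= B / (x - 1).
Proof.
move=> x3 xq kE M0 B0 Mlow Mup /=.
have x_gt1 : 1 < x by apply: lt_le_trans x3; rewrite ltr1n.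
have x0 : 0 < x := lt_trans ltr01 x_gt1.
have x1 : 0 < x - 1 by rewrite subr_gt0.
have q0 : 0 < q := lt_le_trans x0 xq.
have q2 : 0 < q - 1 - 1.
  have -> : q - 1 - 1 = q - 2 by ring.
  by rewrite subr_gt0; apply: lt_le_trans xq; apply: lt_le_trans x3; rewrite ltr_nat.
have k0 : 0 < k by rewrite kE divr_gt0 ?mulr_gt0 ?ltr0n.
have xq2 : 0 < x * (q - 1 - 1) + q by rewrite addr_gt0 ?mulr_gt0.
have nkE : q - 1 - k = (x * (q - 1 - 1) + q) / (2 * x).
  by rewrite kE; field; rewrite gt_eqF.
have nk0 : 0 < q - 1 - k by rewrite nkE divr_gt0 ?mulr_gt0 ?ltr0n.
set w2 := (q - 1 - k) / _.
have w0 : 0 < w2 by rewrite divr_gt0 ?mulr_gt0.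
have sw0 : 0 < sqrtC w2 by rewrite sqrtC_gt0.
split.
  rewrite ler_pdivlMr // mul1r -(@ler_pXn2r _ 2) ?nnegrE ?(ltW sw0) //.
  (* After clearing the denominator, one more factor [k] turns the claim into [Mlow]. *)
  rewrite sqrtCK ler_pdivrMr ?mulr_gt0 // -(ler_pM2l k0).
  move: Mlow; congr (_ <= _); ring.
rewrite expr_div_n sqrtCK.
(* [c] is the factor carrying the square of [2 * (k * M)], which [Mup] controls, to the square of
   the ratio. *)
pose c := (q - 1 - 1) / (4 * k * (q - 1 - k)).
have c0 : 0 <= c by rewrite ltW // divr_gt0 ?mulr_gt0 ?ltr0n.
have nz := (gt_eqF x0, gt_eqF x1, gt_eqF q0, gt_eqF q2, gt_eqF k0, gt_eqF nk0, gt_eqF xq2).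
have -> : M ^+ 2 / w2 = (2 * (k * M)) ^+ 2 * c.
  by rewrite /w2 /c; field; rewrite ?nz.
apply: (le_trans (ler_wpM2r c0 Mup)).
(* Substituting [k] leaves the target times a fraction smaller than 1, whose denominator exceeds its
   numerator by [q]. *)
have -> : q / x * B * c = B / (x - 1) * (x * (q - 1 - 1) / (x * (q - 1 - 1) + q)).
  by rewrite /c nkE kE; field; rewrite ?nz.
rewrite ler_piMr ?divr_ge0 ?(ltW x1) // ler_pdivrMr // mul1r lerDl ltW //.
Qed.

(** * Characters of the unit group as irreducible characters *)

Section UnitExtension.
Variable F : finFieldType.
Local Notation G := [set: {unit F}]%G.

Lemma sum_units (g : F -> algC) : g 0 = 0 ->
  \sum_(u : {unit F}) g (val u) = \sum_x g x.
Proof.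
move=> g0; rewrite [RHS](bigID [pred x : F | x \is a GRing.unit]) /=.
rewrite [X in _ + X]big1 ?addr0 => [|x]; last by rewrite unitfE negbK => /eqP ->.
rewrite [RHS](reindex_omap (val : {unit F} -> F) insub) /= => [|x ux].
  by apply: eq_bigl => u; rewrite valK eqxx andbT (valP u).
by rewrite insubT.
Qed.

Definition ext0 (phi : {unit F} -> algC) (x : F) : algC :=
  if insub x is Some u then phi u else 0.

Lemma ext0_val phi (u : {unit F}) : ext0 phi (val u) = phi u.
Proof. by rewrite /ext0 valK. Qed.

Lemma ext0_0 phi : ext0 phi 0 = 0.
Proof. by rewrite /ext0 insubF // unitr0. Qed.

Lemma neq0_unit (x : F) : x != 0 -> exists u : {unit F}, x = val u.
Proof.
move=> x0; have ux : x \is a GRing.unit by rewrite unitfE.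
by exists (FinRing.Unit ux). Qed.

Lemma mult_char1 (phi : {unit F} -> algC) : is_mult_char phi -> phi 1%g = 1.
Proof.
case=> phiM phi0; apply: (mulfI (phi0 1%g)); by rewrite -phiM mulg1 mulr1.
Qed.

Lemma ext0_field_char phi : is_mult_char phi -> field_char (ext0 phi).
Proof.
move=> phiP; split; first exact: ext0_0.
  by rewrite -[1]/(val (1%g : {unit F})) ext0_val mult_char1.
move=> x y; have [->|/neq0_unit [u ->]] := eqVneq x 0; first by rewrite mul0r ext0_0 mul0r.
have [->|/neq0_unit [v ->]] := eqVneq y 0; first by rewrite mulr0 ext0_0 mulr0.
rewrite -[val u * val v]/(val (u * v)%g) !ext0_val; exact: phiP.1.
Qed.

Lemma norm_mult_char (phi : {unit F} -> algC) u : is_mult_char phi -> `|phi u| = 1.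
Proof.
move=> /ext0_field_char /norm_field_char - /(_ (val u)); rewrite ext0_val; apply.
by rewrite -unitfE (valP u).
Qed.

Lemma ext0_sum0 phi : is_mult_char phi -> (exists u, phi u != 1) ->
  \sum_x ext0 phi x = 0.
Proof.
move=> phiP [u phiu]; have [_ _ extM] := ext0_field_char phiP.
have [||one] := @mult_fun_sum F #|F| (ext0 phi).
- by move=> x y _ _; apply: extM.
- by rewrite (eq_bigl xpredT) // => x; rewrite inE expf_card eqxx.
have := one (val u); rewrite ext0_val inE expf_card eqxx -unitfE (valP u).
by move=> /(_ isT isT) phiu1; rewrite phiu1 eqxx in phiu.
Qed.

Lemma mult_char_ratio (phi psi : {unit F} -> algC) : is_mult_char phi -> is_mult_char psi ->
  is_mult_char (fun u : {unit F} => phi u * (psi u)^*).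
Proof.
case=> phiM phi0 [psiM psi0]; split=> [u v|u].
  by rewrite phiM psiM rmorphM mulrACA.
by rewrite mulf_neq0 // conjC_eq0.
Qed.

Lemma mult_char_triv : is_mult_char (fun _ : {unit F} => 1).
Proof. by split=> [u v|u]; rewrite ?mulr1 ?oner_eq0. Qed.

Lemma unit_abelian : abelian G.
Proof. exact/cyclic_abelian/field_unit_group_cyclic. Qed.

Lemma irr_mult_char (i : Iirr G) : is_mult_char 'chi_i.
Proof.
have lin := char_abelianP _ unit_abelian i.
split=> [u v|u]; first by rewrite lin_charM ?inE.
by rewrite lin_char_neq0 ?inE.
Qed.

(** The scalar matrices [(phi u)%:M] form a representation of degree one, whose character is linear
    and hence irreducible. The set E is thereby indexed by the finite type [Iirr G], where
    orthogonality and maxima are available. *)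
Lemma mult_char_irr (phi : {unit F} -> algC) : is_mult_char phi -> exists i : Iirr G, phi =1 'chi_i.
Proof.
move=> phiP; have [phiM _] := phiP.
have rP : mx_repr G (fun u : {unit F} => (phi u)%:M : 'M[algC]_1).
  split=> [|u v _ _]; first by rewrite mult_char1.
  by rewrite phiM scalar_mxM.
pose rG := MxRepresentation rP.
have phiE u : cfRepr rG u = phi u.
  by rewrite cfunE inE /= mxtrace_scalar.
have lin : cfRepr rG \is a linear_char.
  by rewrite qualifE /= cfRepr_char cfRepr1 eqxx.
have /irrP [i chiE] := lin_char_irr lin.
by exists i => u; rewrite -chiE phiE.
Qed.

(** Expand and sum over the characters first. By column orthogonality only the pairs [u = v]
    survive; the group being abelian, classes are singletons and each such pair contributes
    [#|G|]. *)
Lemma irr_sum_sqr (D : {set {unit F}}) :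
  \sum_(i : Iirr G) `|\sum_(u in D) 'chi_i u| ^+ 2 = #|G|%:R * #|D|%:R.
Proof.
have conjE i : `|\sum_(u in D) 'chi[G]_i u| ^+ 2 =
    \sum_(u in D) \sum_(v in D) 'chi_i u * ('chi_i v)^*.
  rewrite normCK rmorph_sum mulr_suml; apply: eq_bigr => u _.
  by rewrite mulr_sumr.
rewrite (eq_bigr _ (fun i _ => conjE i)) exchange_big /=.
rewrite -[#|D|]sum1_card natr_sum mulr_sumr; apply: eq_bigr => u uD.
rewrite exchange_big /= (bigD1 u) //= [X in _ + X]big1 ?addr0 => [|v /andP [_ vu]].
  rewrite second_orthogonality_relation ?inE // class_refl mulr1.
  by rewrite (setIidPl _) // sub_cent1 (subsetP unit_abelian) ?inE.
rewrite second_orthogonality_relation ?inE //.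
suff -> : (u \in (v ^: G)%g) = false by [].
apply/imsetP => -[w _]; rewrite conjgE (centsP unit_abelian v _ w) ?inE // mulKg => uv.
by rewrite uv eqxx in vu.
Qed.

End UnitExtension.

(** * The trace onto the subfield and its distribution *)

Section Trace.
Variables (F : finFieldType) (p t s : nat).
Hypotheses (p_pr : prime p) (t_gt0 : (0 < t)%N) (s_gt0 : (0 < s)%N).
Hypothesis cardF : #|F| = (p ^ (t * s))%N.
Local Notation r := (p ^ t)%N.
Local Notation A := (@fixed_set F r).
Local Notation tr := (trace_qr r s).

Lemma pcharF : p \in [pchar F].
Proof. exact: card_finPcharP cardF p_pr. Qed.

Lemma frobeniusD k (x y : F) : (x + y) ^+ (p ^ k) = x ^+ (p ^ k) + y ^+ (p ^ k).
Proof. by apply: exprDn_pchar; rewrite (eq_pnat _ (pcharf_eq pcharF)) pnatX pnat_id. Qed.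

Lemma card_base_gt1 : (1 < r)%N.
Proof. by rewrite -(exp1n t) ltn_exp2r // prime_gt1. Qed.

Lemma card_base_gt0 : (0 < r)%N. Proof. exact: ltnW card_base_gt1. Qed.

Lemma card_base_neq0 : r%:R != 0 :> algC.
Proof. by rewrite pnatr_eq0 -lt0n card_base_gt0. Qed.

Lemma fixed_set0 : 0 \in A.
Proof. by rewrite inE expr0n -leqn0 leqNgt card_base_gt0. Qed.

Lemma fixed_set1 : 1 \in A.
Proof. by rewrite inE expr1n. Qed.

Lemma fixed_setD x y : x \in A -> y \in A -> x + y \in A.
Proof. by rewrite !inE frobeniusD => /eqP -> /eqP ->. Qed.

Lemma fixed_setN x : x \in A -> - x \in A.
Proof.
rewrite !inE => /eqP xA; rewrite -addr_eq0 -{2}xA -frobeniusD.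
by rewrite addNr expr0n -leqn0 leqNgt card_base_gt0.
Qed.

Lemma fixed_setB x y : x \in A -> y \in A -> x - y \in A.
Proof. by move=> xA yA; rewrite fixed_setD ?fixed_setN. Qed.

Lemma fixed_set_nat n : n%:R \in A.
Proof.
by elim: n => [|n IHn]; rewrite ?fixed_set0 // mulrS fixed_setD ?fixed_set1.
Qed.

Lemma fixed_setX x i : x \in A -> x ^+ (r ^ i) = x.
Proof.
move=> xA; elim: i => [|i IHi]; first by rewrite expr1.
by rewrite expnSr exprM IHi (eqP xA).
Qed.

Lemma trace_qrD : {morph (fun x : F => tr x) : x y / x + y}.
Proof.
move=> x y; rewrite /trace_qr -big_split /=; apply: eq_bigr => i _.
by rewrite -expnM frobeniusD.
Qed.

Lemma trace_qrZ c x : c \in A -> tr (c * x) = c * tr x.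
Proof.
move=> cA; rewrite /trace_qr mulr_sumr; apply: eq_bigr => i _.
by rewrite exprMn (fixed_setX _ cA).
Qed.

Lemma trace_qr0 : tr (0 : F) = 0.
Proof. by rewrite -[X in tr X](mul0r 0) trace_qrZ ?fixed_set0 ?mul0r. Qed.

Lemma trace_qrB x y : tr (x - y : F) = tr x - tr y.
Proof. by apply: (addIr (tr y)); rewrite -trace_qrD !subrK. Qed.

Lemma trace_qr1 : tr (1 : F) = s%:R.
Proof.
rewrite /trace_qr (eq_bigr (fun=> 1)) => [|i _]; last by rewrite expr1n.
by rewrite sumr_const card_ord.
Qed.

Lemma card_field_base : #|F| = (r ^ s)%N. Proof. by rewrite -expnM. Qed.

(** Raising to the power r permutes the summands cyclically, since [x ^+ (r ^ s) = x]. *)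
Lemma trace_qr_fixed x : tr (x : F) \in A.
Proof.
have sumX n (f : nat -> F) : (\sum_(i < n) f i) ^+ r = \sum_(i < n) f i ^+ r.
  elim: n => [|n IHn]; last by rewrite !big_ord_recr /= frobeniusD IHn.
  by rewrite !big_ord0; apply/eqP/fixed_set0.
have xs : x ^+ (r ^ s) = x by rewrite -card_field_base expf_card.
rewrite inE /trace_qr (sumX s (fun i => x ^+ (r ^ i))) /=; case: s s_gt0 xs => // n _ xs.
rewrite big_ord_recr big_ord_recl /= -exprM -expnSr xs expr1 addrC.
by apply/eqP; congr (_ + _); apply: eq_bigr => i _; rewrite -exprM -expnSr.
Qed.

(** The trace is a polynomial function of degree [r ^ s.-1], which bounds its number of roots. *)
Lemma card_trace_qr_ker_leq : (#|[set x : F | tr x == 0%R]| <= r ^ s.-1)%N.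
Proof.
pose P : {poly F} := \sum_(i < s) 'X^(r ^ i).
have szP : size P = (r ^ s.-1).+1.
  rewrite /P; case: s s_gt0 => // n _; rewrite big_ord_recr /= addrC.
  rewrite size_polyDl size_polyXn //.
  apply: leq_trans (size_sum _ _ _) _; apply/bigmax_leqP => i _.
  by rewrite size_polyXn ltn_exp2l // card_base_gt1.
have P0 : P != 0 by rewrite -size_poly_eq0 szP.
rewrite cardE -ltnS -szP; apply: max_poly_roots => //; last exact: enum_uniq.
apply/allP => x; rewrite mem_enum inE => /eqP trx.
rewrite /root /P horner_sum -[X in _ == X]trx; apply/eqP/eq_bigr => i _.
by rewrite hornerXn.
Qed.

Lemma card_fixed_set_leq : (#|A| <= r)%N.
Proof.
have szP : size ('X^r - 'X : {poly F}) = r.+1.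
  by rewrite size_polyDl size_polyXn // size_polyN size_polyX ltnS card_base_gt1.
have P0 : ('X^r - 'X : {poly F}) != 0 by rewrite -size_poly_eq0 szP.
rewrite cardE -ltnS -szP; apply: max_poly_roots => //; last exact: enum_uniq.
apply/allP => x; rewrite mem_enum inE => /eqP xA.
by rewrite /root !hornerE xA subrr.
Qed.

(** The kernel is too small to be all of [F], so some trace is nonzero; linearity over the subfield
    rescales it to [b]. *)
Lemma trace_qr_surj b : b \in A -> exists x : F, tr x = b.
Proof.
move=> bA; have [x trx] : exists x : F, tr x != 0.
  apply/existsP; rewrite -negb_forall; apply/negP => /forallP trace_qr0.
  have := card_trace_qr_ker_leq; rewrite (eq_card (B := F)) ?card_field_base.
    by rewrite leq_exp2l ?card_base_gt1 // -ltnS prednK // ltnn.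
  by move=> x; rewrite inE trace_qr0.
exists (b / tr x * x); rewrite trace_qrZ ?fixed_setM ?fixed_setV ?trace_qr_fixed //.
by rewrite mulfVK.
Qed.

Lemma sum_trace_qr_ker (f : F -> algC) :
  \sum_x f (tr x) = #|[set x : F | tr x == 0%R]|%:R * \sum_(a in A) f a.
Proof.
apply: sum_fibres => [x y||]; [|exact: trace_qr_fixed|exact: trace_qr_surj].
by rewrite inE trace_qrB subr_eq0.
Qed.

(** The sizes of the kernel and of the image multiply to [r ^ s], while they are at most [r ^ s.-1]
    and r; both bounds must be attained. *)
Lemma card_fixed_set : #|A| = r.
Proof.
apply/eqP; rewrite eqn_leq card_fixed_set_leq /=.
have : #|F| = (#|[set x : F | tr x == 0%R]| * #|A|)%N.
  have := sum_trace_qr_ker (fun=> 1); rewrite !sumr_const => /eqP.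
  by rewrite -natrM eqr_nat => /eqP.
move=> cF; rewrite -(@leq_pmul2l (r ^ s.-1)) ?expn_gt0 ?prime_gt0 //.
rewrite -expnSr prednK // -card_field_base cF leq_mul2r card_trace_qr_ker_leq.
by rewrite orbT.
Qed.

Lemma sum_trace_qr (f : F -> algC) :
  \sum_x f (tr x) = #|F|%:R / r%:R * \sum_(a in A) f a.
Proof.
rewrite (sum_trace_qr_ker f); congr (_ * _).
have := sum_trace_qr_ker (fun=> 1); rewrite !sumr_const card_fixed_set => ->.
by rewrite mulfK // card_base_neq0.
Qed.

(** For [u] outside the subfield the two trace forms are linearly independent over it, so the pair
    of them maps onto its square with fibres of equal size. *)
Lemma sum_trace_qr_joint u (f g : F -> algC) : u \notin A ->
  \sum_x f (tr (u * x)) * g (tr x) =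
  #|F|%:R / r%:R ^+ 2 * ((\sum_(a in A) f a) * (\sum_(a in A) g a)).
Proof.
move=> uA.
have [y0 try0] := trace_qr_surj fixed_set1.
have [y1 /eqP try1 truy1] : exists2 y : F, tr y == 0 & tr (u * y) != 0.
  apply/exists_inP; apply: contraR uA; rewrite negb_exists_in => /forall_inP ker.
  (* If the kernel of [tr] lay in that of [x |-> tr (u * x)], the second form would be [c] times the
     first; then [tr] would vanish on all multiples of [u - c], whence [u = c] lies in [A]. *)
  set c := tr (u * y0); have cA : c \in A by apply: trace_qr_fixed.
  have uc x : tr ((u - c) * x) = 0.
    rewrite mulrBl trace_qrB (trace_qrZ _ cA); apply/eqP; rewrite subr_eq0; apply/eqP.
    have /eqP : tr (x - tr x * y0) == 0.
      by rewrite trace_qrB trace_qrZ ?trace_qr_fixed // try0 mulr1 subrr.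
    move=> /eqP /ker; rewrite negbK mulrBr mulrCA trace_qrB (trace_qrZ _ (trace_qr_fixed x)) //.
    by rewrite subr_eq0 [_ * c]mulrC => /eqP.
  suff /eqP -> : u == c by [].
  rewrite -subr_eq0; apply: contraT => d0.
  by have := uc ((u - c)^-1 * y0); rewrite mulVKf // try0 => /eqP; rewrite oner_eq0.
pose L (x : F) : F * F := (tr (u * x), tr x).
pose B : {pred F * F} := [pred ab | (ab.1 \in A) && (ab.2 \in A)].
pose K := [set x : F | L x == 0].
have LK x y : (L x == L y) = (x - y \in K).
  by rewrite inE /L -!pair_eqE /= mulrBr !trace_qrB !subr_eq0.
have LB x : L x \in B by rewrite inE /= !trace_qr_fixed.
have Lsurj b : b \in B -> exists x, L x = b.
  case: b => a b /andP [/= aA bA].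
  have cA : (a - b * tr (u * y0)) / tr (u * y1) \in A.
    by rewrite ?(fixed_setM, fixed_setB, fixed_setV, trace_qr_fixed).
  (* The system is triangular: [y1] has trace 0, so the coefficient of [y0] fixes the second
     coordinate and that of [y1] then corrects the first. *)
  exists (b * y0 + (a - b * tr (u * y0)) / tr (u * y1) * y1).
  rewrite /L mulrDr !(mulrCA u) !trace_qrD !(trace_qrZ _ cA) !(trace_qrZ _ bA) try0 try1.
  by rewrite mulr0 addr0 mulr1 mulfVK // addrC subrK.
have sumL (h : F * F -> algC) := sum_fibres h LK LB Lsurj.
have sumB (h k : F -> algC) :
    \sum_(b in B) h b.1 * k b.2 = (\sum_(a in A) h a) * (\sum_(a in A) k a).
  rewrite mulr_suml; under [RHS]eq_bigr do rewrite mulr_sumr.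
  by rewrite pair_big.
rewrite (sumL (fun b => f b.1 * g b.2)) sumB; congr (_ * _).
(* Constant functions give the size of [K]. *)
have := sumL (fun b => 1 * 1); rewrite (sumB (fun=> 1) (fun=> 1)).
rewrite mulr1 !sumr_const card_fixed_set => ->.
by rewrite -expr2 mulfK // expf_neq0 // card_base_neq0.
Qed.

(** * The quadratic character of the subfield *)

Hypotheses (p_odd : odd p) (p_s : ~~ (p %| s)%N).
Local Notation h := (r.-1)./2.
Local Notation eta := (@quad_char F r).
Local Notation N := #|F|.-1.

Lemma card_base_pred : r.-1 = h.*2.
Proof. by rewrite halfK -subn1 oddB ?card_base_gt0 // oddX p_odd orbT subn0. Qed.

Lemma half_card_base_gt0 : (0 < h)%N.
Proof. by rewrite -double_gt0 -card_base_pred -subn1 subn_gt0 card_base_gt1. Qed.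

Lemma card_units_gt0 : (0 < N)%N.
Proof. by rewrite -ltnS prednK ?finNzRing_gt1 // ltnW // finNzRing_gt1. Qed.

Lemma half_card_base_dvd : exists2 M, (0 < M)%N & N = (h.*2 * M)%N.
Proof.
have NE : N = (h.*2 * \sum_(i < s) r ^ i)%N by rewrite -card_base_pred card_field_base predn_exp.
exists (\sum_(i < s) r ^ i)%N => //.
by rewrite lt0n; apply: contraTneq card_units_gt0 => M0; rewrite NE M0 muln0.
Qed.

Lemma fixed_setE x : x != 0 -> (x \in A) = (x ^+ h.*2 == 1).
Proof.
move=> x0; rewrite inE -card_base_pred -[RHS](inj_eq (mulfI x0)) mulr1 -exprS.
by rewrite prednK ?card_base_gt0.
Qed.

(** Write [y = g ^+ i] with [g] primitive and [N = 2 * h * M]. Then [y ^+ h = 1] means that [2 * M]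
    divides [i], say with quotient [j], and [g ^+ (j * M)] is a square root of [y] fixed by the
    power r. *)
Lemma euler_criterion y : y != 0 ->
  [exists z : F, (z ^+ r == z) && (z ^+ 2 == y)] = (y ^+ h == 1).
Proof.
move=> y0; apply/existsP/idP => [[z /andP [zA /eqP zy]]|].
  have z0 : z != 0 by apply: contraNneq y0 => z0; rewrite -zy z0 expr0n.
  by rewrite -zy -exprM mul2n -fixed_setE.
have [g [gP gN]] := primitive_element F; have [i yi] := gP y y0.
rewrite {}yi in y0 *; have [M M0 NE] := half_card_base_dvd.
have hE : (h.*2 * M = h * (2 * M))%N by lia.
rewrite -exprM gN NE hE [(i * h)%N]mulnC dvdn_pmul2l ?half_card_base_gt0 // => /dvdnP [j ij].
have gj2 : (g ^+ (j * M)) ^+ 2 = g ^+ i by rewrite -exprM; congr (_ ^+ _); lia.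
exists (g ^+ (j * M)); rewrite gj2.
have gj0 : g ^+ (j * M) != 0.
  by apply: contraNneq y0 => g0; rewrite -gj2 g0 expr0n.
have := fixed_setE gj0; rewrite inE => ->; rewrite eqxx andbT -exprM gN NE.
by apply/dvdnP; exists j; lia.
Qed.

Lemma quad_char_euler y : eta y = if y == 0 then 0 else if y ^+ h == 1 then 1 else -1.
Proof. by rewrite /quad_char; case: eqVneq => // y0; rewrite euler_criterion. Qed.

Lemma quad_char0 : eta 0 = 0. Proof. by rewrite /quad_char eqxx. Qed.

Lemma quad_char_conj y : (eta y)^* = eta y.
Proof. by rewrite /quad_char; case: ifP => _; [|case: ifP => _]; rewrite ?rmorph0 ?rmorphN1 ?rmorph1. Qed.

Lemma quad_char_sqr y : y != 0 -> eta y * eta y = 1.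
Proof.
by move=> y0; rewrite /quad_char (negPf y0); case: ifP => _; rewrite ?mulrNN mulr1.
Qed.

Lemma fieldN1_neq1 : (-1 == 1 :> F) = false.
Proof.
rewrite eq_sym -addr_eq0 -[1 + 1]/(2%:R) -(dvdn_pcharf pcharF).
rewrite gtnNdvd // ltn_neqAle prime_gt1 // andbT.
by apply: contraTneq p_odd => <-.
Qed.

Lemma fixed_pow_h y : y \in A -> y != 0 -> y ^+ h = 1 \/ y ^+ h = -1.
Proof.
move=> yA y0; have : (y ^+ h) ^+ 2 == 1 by rewrite -exprM muln2 -fixed_setE.
by rewrite sqrf_eq1 => /orP [] /eqP; [left | right].
Qed.

Lemma quad_charM : {in A &, {morph eta : x y / x * y}}.
Proof.
move=> x y xA yA; rewrite !quad_char_euler mulf_eq0.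
case: eqVneq => [_|x0] /=; first by rewrite mul0r.
case: eqVneq => [_|y0] /=; first by rewrite mulr0.
have neg1 := fieldN1_neq1.
case: (fixed_pow_h xA x0) (fixed_pow_h yA y0) => xh [] yh.
all: by rewrite exprMn xh yh ?eqxx ?neg1 ?mulrNN ?mulr1 ?mul1r ?eqxx ?neg1.
Qed.

(** [g ^+ M] has order [h.*2], so its power [h] is not 1. *)
Lemma fixed_nonsquare : exists n, [/\ n \in A, n != 0 & eta n = -1].
Proof.
have [g [gP gN]] := primitive_element F; have [M M0 NE] := half_card_base_dvd.
have n0 : g ^+ M != 0.
  apply/eqP => gM; have : g ^+ (N * M) == 1 by rewrite gN dvdn_mulr.
  rewrite mulnC exprM gM expr0n -leqn0 leqNgt card_units_gt0 eq_sym oner_eq0 //.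
exists (g ^+ M); split=> //.
  by rewrite fixed_setE // -exprM gN NE mulnC.
rewrite quad_char_euler (negPf n0) -exprM gN NE ifN //.
have Mh_gt0 : (0 < M * h)%N by rewrite muln_gt0 M0 half_card_base_gt0.
by apply/negP => /(dvdn_leq Mh_gt0); lia.
Qed.

Lemma sum_quad_char : \sum_(a in A) eta a = 0.
Proof.
have [n [nA n0 etan]] := fixed_nonsquare.
have := sum_fixed_dilation eta n0 nA.
rewrite (eq_bigr (fun a => - eta a)) => [|a aA]; last by rewrite quad_charM // etan mulrN1.
rewrite sumrN => /eqP; rewrite eq_sym -addr_eq0 -mulr2n mulrn_eq0 /=.
by move/eqP.
Qed.

Lemma sum_fixed_neq0 : \sum_(a in A | a != 0) 1 = r%:R - 1 :> algC.
Proof.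
have := sumr_const A (1 : algC); rewrite (bigD1 0) ?fixed_set0 //= card_fixed_set => <-.
by rewrite [1 + _]addrC addrK.
Qed.

Lemma sum_quad_char_sqr : \sum_(a in A) eta a * eta a = r%:R - 1.
Proof.
rewrite (bigD1 0) ?fixed_set0 //= quad_char0 mul0r add0r.
rewrite -sum_fixed_neq0; apply: eq_bigr => a /andP [_ a0]; exact: quad_char_sqr.
Qed.

(** * Quadratic and Jacobi sums over the subfield *)

Lemma sum_fixed_translation (R : nmodType) c (f : F -> R) : c \in A ->
  \sum_(x in A) f (x + c) = \sum_(x in A) f x.
Proof.
move=> cA; rewrite [RHS](reindex_inj (addIr c)) /=; apply: eq_bigl => x.
by apply/idP/idP => [xA|/fixed_setB /(_ cA)]; rewrite ?addrK // fixed_setD.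
Qed.

Lemma sum_fixed_affine (R : nmodType) c d (f : F -> R) : c \in A -> c != 0 -> d \in A ->
  \sum_(x in A) f (x * c + d) = \sum_(x in A) f x.
Proof.
move=> cA c0 dA; rewrite (sum_fixed_dilation (fun x => f (x + d)) c0 cA).
exact: sum_fixed_translation.
Qed.

(** Translating by [- c] gives the sum of [eta ((u * z + d) * z)]; the inversion of [z] then makes
    the argument affine. The affine sum over all of [A] vanishes, and [- eta u] accounts for its
    missing term at 0. *)
Lemma sum_quad_char_quadratic u c : u \in A -> u != 1 -> c \in A -> c != 0 ->
  \sum_(y in A) eta (u * y + c) * eta (y + c) = - eta u.
Proof.
move=> uA u1 cA c0; set d := c * (1 - u).
have dA : d \in A by rewrite fixed_setM ?fixed_setB ?fixed_set1.
have d0 : d != 0 by rewrite mulf_neq0 // subr_eq0 eq_sym.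
rewrite -(sum_fixed_translation _ (fixed_setN cA)).
rewrite (eq_bigr (fun z => eta (u * z + d) * eta z)) => [|z zA]; last first.
  by rewrite subrK; congr (eta _ * _); rewrite /d; ring.
rewrite (bigD1 0) ?fixed_set0 //= quad_char0 mulr0 add0r.
(* For z != 0, eta ((u z + d) z) = eta (u + d / z), since z ^ 2 is a square. *)
have invE : forall z : F, ((z^-1 \in A) && (z^-1 != 0)) = ((z \in A) && (z != 0)).
  move=> z; rewrite invr_eq0; congr (_ && _).
  by apply/idP/idP => /fixed_setV //; rewrite invrK.
rewrite (reindex_inj (@invr_inj F)) /= (eq_bigl _ _ invE).
rewrite (eq_bigr (fun z => eta (z * d + u))) => [|z /andP [zA z0]]; last first.
  have zV := fixed_setV zA; have zV0 : z^-1 != 0 by rewrite invr_eq0.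
  have uzA : u * z^-1 + d \in A by apply: fixed_setD => //; apply: fixed_setM.
  have zuA : z * d + u \in A by apply: fixed_setD => //; apply: fixed_setM.
  rewrite -[RHS]mulr1 -(quad_char_sqr zV0) -!quad_charM ?fixed_setM //.
  by congr eta; field.
have := sum_fixed_affine eta dA d0 uA.
rewrite sum_quad_char (bigD1 0) ?fixed_set0 //= mul0r add0r addrC => /eqP.
by rewrite addr_eq0 => /eqP.
Qed.

(** The squared modulus equals r minus the sum of [chi a * eta a], and that sum is 0 or, when the
    product is trivial, nonnegative. *)
Lemma jacobi_sum_bound (chi : F -> algC) c : field_char chi ->
  \sum_(a in A) chi a = 0 -> c \in A -> c != 0 ->
  `|\sum_(a in A) chi a * eta (a + c)| ^+ 2 <= r%:R.
Proof.
move=> chiP sum0 cA c0; case: (chiP) => chi0 chi1 chiM.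
rewrite (sqr_norm_char_sum r (fun a => eta (a + c)) chiP).
rewrite (eq_bigr (fun u => chi u * (u == 1)%:R * r%:R - chi u - chi u * eta u));
  last first.
  (* The subtracted 1 is the term [y = 0], where both factors are [eta c]. *)
  move=> u uA; transitivity (chi u *
      ((\sum_(y in A) eta (u * y + c) * eta (y + c)) - 1)).
    congr (_ * _); rewrite [in RHS](bigD1 0) ?fixed_set0 //= mulr0 add0r quad_char_sqr //.
    by rewrite [1 + _]addrC addrK; apply: eq_bigr => y _; rewrite quad_char_conj.
  have [->|u1] := eqVneq u 1; last first.
    by rewrite sum_quad_char_quadratic // mulr0n; ring.
  have eta1 : eta 1 = 1.
    by rewrite quad_char_euler oner_eq0 expr1n eqxx.
  under eq_bigr do rewrite mul1r.
  by rewrite (sum_fixed_translation (fun y => eta y * eta y) cA) sum_quad_char_sqr eta1 mulr1n; ring.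
rewrite !sumrB sum0 subr0 -mulr_suml (bigD1 1) ?fixed_set1 //= big1 ?addr0; last first.
  by move=> u /andP [_ /negPf ->]; rewrite mulr0.
rewrite eqxx mulr1 chi1 mul1r lerBlDr lerDl.
have [x y xA yA|->//|one] := @mult_fun_sum F r (fun a => chi a * eta a).
  by rewrite chiM quad_charM //; ring.
rewrite (bigD1 0) ?fixed_set0 //= chi0 mul0r add0r.
by apply: sumr_ge0 => a /andP [aA a0]; rewrite one.
Qed.

(** * The weight describing D and its character sums *)

Local Notation sC := (s%:R : F).

Lemma natF_neq0 : sC != 0.
Proof. by rewrite -(dvdn_pcharf pcharF). Qed.

Definition D_weight (a : F) : algC := (eta (a + sC) == - eta sC)%:R.

Lemma quad_char_pm1 y : y != 0 -> eta y = 1 \/ eta y = -1.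
Proof. by rewrite /quad_char => /negPf ->; case: ifP => _; [left | right]. Qed.

Lemma algCN1_neq1 : (-1 == 1 :> algC) = false.
Proof. by apply/negbTE; rewrite lt_eqF // (lt_trans (ltrN10 _) ltr01). Qed.

(** Since p does not divide s, [eta sC] is 1 or -1 and differs from its opposite. Hence [x = 0] has
    weight 0, and sums over D extend to all of [F]. *)
Lemma D_weight0 : D_weight 0 = 0.
Proof.
rewrite /D_weight add0r; case: (quad_char_pm1 natF_neq0) => ->.
  by rewrite eq_sym algCN1_neq1.
by rewrite opprK algCN1_neq1.
Qed.

(** The last term of the numerator cancels the 1 at [a = - sC], where [eta] is 0 and the weight must
    vanish. *)
Lemma D_weightE a : D_weight a = (1 - eta sC * eta (a + sC) - (a == - sC)%:R) / 2%:R.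
Proof.
have n1 := algCN1_neq1; have n1' : (1 == -1 :> algC) = false by rewrite eq_sym.
rewrite /D_weight -[a == - sC]addr_eq0.
have [->|as0] := eqVneq (a + sC) 0.
  rewrite quad_char0 mulr0 subr0 subrr mul0r.
  by case: (quad_char_pm1 natF_neq0) => ->; rewrite ?opprK eq_sym ?oppr_eq0 oner_eq0.
rewrite subr0; case: (quad_char_pm1 as0) (quad_char_pm1 natF_neq0) => -> [] ->.
- by rewrite n1' mulr1 subrr mul0r.
- by rewrite opprK eqxx mulr1 opprK -[1 + 1]/(2%:R) divff ?pnatr_eq0.
- by rewrite eqxx mul1r opprK -[1 + 1]/(2%:R) divff ?pnatr_eq0.
- by rewrite opprK n1 mulrNN mulr1 subrr mul0r.
Qed.

Lemma D_weight_conj a : (D_weight a)^* = D_weight a.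
Proof. by rewrite /D_weight conjC_nat. Qed.

Lemma sum_D_weight : \sum_(a in A) D_weight a = (r%:R - 1) / 2%:R.
Proof.
rewrite (eq_bigr _ (fun a _ => D_weightE a)) -mulr_suml !sumrB sumr_const card_fixed_set.
rewrite -mulr_sumr (sum_fixed_translation eta (fixed_set_nat s)) sum_quad_char mulr0 subr0.
congr ((_ - _) / _); rewrite (bigD1 (- sC)) ?fixed_setN ?fixed_set_nat //= eqxx.
by rewrite big1 ?addr0 // => a /andP [_ /negPf ->].
Qed.

Lemma norm_char_D_weight_sum (chi : F -> algC) : field_char chi ->
  \sum_(a in A) chi a = 0 ->
  `|2%:R * \sum_(a in A) chi a * D_weight a| <= 1 + sqrtC r%:R.
Proof.
move=> chiP sum0.
have -> : 2%:R * (\sum_(a in A) chi a * D_weight a) =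
    - chi (- sC) - eta sC * \sum_(a in A) chi a * eta (a + sC).
  rewrite mulr_sumr (eq_bigr (fun a => chi a - eta sC * (chi a * eta (a + sC)) -
      chi a * (a == - sC)%:R)) => [|a _].
    rewrite !sumrB sum0 sub0r -mulr_sumr addrC; congr (- _ - _).
    rewrite (bigD1 (- sC)) ?fixed_setN ?fixed_set_nat //= eqxx mulr1.
    by rewrite big1 ?addr0 // => a /andP [_ /negPf ->]; rewrite mulr0.
  by rewrite D_weightE; field.
apply: le_trans (ler_normB _ _) _; rewrite normrN normrM; apply: lerD.
  by rewrite norm_field_char // oppr_eq0 natF_neq0.
have -> : `|eta sC| = 1 by case: (quad_char_pm1 natF_neq0) => ->; rewrite ?normrN normr1.
rewrite mul1r -(@ler_pXn2r _ 2) ?nnegrE ?normr_ge0 ?sqrtC_ge0 ?ler0n // sqrtCK.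
exact: jacobi_sum_bound (fixed_set_nat s) natF_neq0.
Qed.

(** For [u] in [A], linearity gives [tr (u * y) = u * tr y], and these terms reassemble into the
    squared sum over [A]. For [u] outside, the inner sum is constant by joint uniformity, and [chi]
    sums there to the opposite of its sum over [A]. *)
Lemma sqr_norm_trace_sum (chi : F -> algC) : field_char chi -> \sum_x chi x = 0 ->
  `|\sum_x chi x * D_weight (tr x)| ^+ 2 =
  #|F|%:R / r%:R * `|\sum_(a in A) chi a * D_weight a| ^+ 2 -
  #|F|%:R / r%:R ^+ 2 * (\sum_(a in A) D_weight a) ^+ 2 * \sum_(a in A) chi a.
Proof.
move=> chiP sum0; have fixF x : x \in @fixed_set F #|F| by rewrite inE expf_card.
have := sqr_norm_char_sum #|F| (fun x => D_weight (tr x)) chiP.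
rewrite (eq_bigl xpredT) // => ->; rewrite (eq_bigl xpredT) //.
have inner u : \sum_(y in @fixed_set F #|F| | y != 0) D_weight (tr (u * y)) * (D_weight (tr y))^* =
    \sum_y D_weight (tr (u * y)) * D_weight (tr y).
  rewrite [RHS](bigD1 0) //= trace_qr0 D_weight0 mulr0 add0r; apply: eq_big => [y|y _].
    by rewrite fixF.
  by rewrite D_weight_conj.
under eq_bigr do rewrite inner.
rewrite (bigID (mem A)) /= (eq_bigr (fun u => #|F|%:R / r%:R *
   (chi u * \sum_(a in A | a != 0) D_weight (u * a) * (D_weight a)^*))) => [|u uA]; last first.
  rewrite mulrCA; congr (_ * _).
  rewrite (eq_bigr (fun y => (fun a => D_weight (u * a) * D_weight a) (tr y))) => [|y _]; last first.
    by rewrite trace_qrZ.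
  rewrite (sum_trace_qr (fun a => D_weight (u * a) * D_weight a)); congr (_ * _).
  rewrite (bigD1 0) ?fixed_set0 //= D_weight0 mulr0 add0r.
  by apply: eq_bigr => a _; rewrite D_weight_conj.
rewrite -mulr_sumr -sqr_norm_char_sum //; congr (_ + _).
rewrite (eq_bigr (fun u => chi u * (#|F|%:R / r%:R ^+ 2 * (\sum_(a in A) D_weight a) ^+ 2)))
  => [|u uA]; last by rewrite sum_trace_qr_joint // expr2.
rewrite -mulr_suml mulrC -mulrN; congr (_ * _).
by move/eqP: sum0; rewrite (bigID (mem A)) /= addrC addr_eq0 => /eqP.
Qed.

(** If [chi] is nontrivial on the subfield, the second term vanishes and the Jacobi bound applies.
    If it is trivial there, both terms are explicit. *)
Lemma char_sum_bound (chi : F -> algC) : field_char chi -> \sum_x chi x = 0 ->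
  (2%:R * `|\sum_x chi x * D_weight (tr x)|) ^+ 2 <=
  #|F|%:R / r%:R * (1 + sqrtC r%:R) ^+ 2.
Proof.
move=> chiP sum0; rewrite exprMn sqr_norm_trace_sum //.
case: (chiP) => chi0 chi1 chiM; have r0 := card_base_neq0.
have chiMA : {in A &, {morph chi : x y / x * y}} by move=> x y _ _; apply: chiM.
have qr0 : 0 <= #|F|%:R / r%:R :> algC by rewrite divr_ge0 ?ler0n.
have sr0 : 0 <= sqrtC r%:R :> algC by rewrite sqrtC_ge0 ler0n.
case: (mult_fun_sum chiMA) => [sumA|one].
  rewrite sumA mulr0 subr0 mulrCA ler_wpM2l //.
  have := norm_char_D_weight_sum chiP sumA; rewrite normrM normr_nat => nV.
  by rewrite -exprMn ler_pXn2r ?nnegrE ?mulr_ge0 ?addr_ge0 ?ler01 ?ler0n.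
have sumA : \sum_(a in A) chi a = r%:R - 1.
  rewrite (bigD1 0) ?fixed_set0 //= chi0 add0r -sum_fixed_neq0.
  by apply: eq_bigr => a /andP [aA a0]; rewrite one.
have sumV : \sum_(a in A) chi a * D_weight a = (r%:R - 1) / 2%:R.
  rewrite -sum_D_weight; apply: eq_bigr => a aA.
  by have [->|a0] := eqVneq a 0; rewrite ?D_weight0 ?mulr0 // one ?mul1r.
have r1 : 0 <= r%:R - 1 :> algC by rewrite subr_ge0 ler1n card_base_gt0.
rewrite sumV sumA sum_D_weight [`|_|]ger0_norm ?divr_ge0 ?ler0n //.
(* In the trivial case the two terms nearly cancel, leaving [(r - 1) ^ 2 / r], which is at most
   r. *)
rewrite [X in X <= _](_ : _ = #|F|%:R / r%:R * ((r%:R - 1) ^+ 2 / r%:R)); last first.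
  by field.
rewrite ler_wpM2l // (le_trans (y := r%:R)) //.
  rewrite ler_pdivrMr ?ltr0n ?card_base_gt0 // -expr2 ler_pXn2r ?nnegrE ?ler0n //.
  by rewrite lerBlDr lerDl ler01.
rewrite -{1}[r%:R]sqrtCK ler_pXn2r ?nnegrE ?addr_ge0 ?ler01 //.
by rewrite lerDr ler01.
Qed.

Lemma card_D_set : #|D_set F r s|%:R = #|F|%:R * (r%:R - 1) / (2 * r%:R) :> algC.
Proof.
have -> : #|D_set F r s|%:R = \sum_(u : {unit F}) D_weight (tr (val u)) :> algC.
  rewrite -sum1_card natr_sum big_mkcond /=; apply: eq_bigr => u _.
  by rewrite inE trace_qrD trace_qr1 /D_weight; case: ifP.
have -> : \sum_(u : {unit F}) D_weight (tr (val u)) = \sum_x D_weight (tr x).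
  by apply: (sum_units (g := fun x => D_weight (tr x))); rewrite trace_qr0 D_weight0.
rewrite sum_trace_qr sum_D_weight; have := card_base_neq0 => r0; by field.
Qed.

(** * Correlations and comparison with the Welch bound *)

Local Notation G := [set: {unit F}]%G.
Local Notation D := (D_set F r s).
Local Notation K := (#|D|%:R : algC).

Lemma sum_D_set (f : {unit F} -> algC) :
  \sum_(u in D) f u = \sum_x ext0 f x * D_weight (tr x).
Proof.
rewrite -(sum_units (g := fun x => ext0 f x * D_weight (tr x))); last by rewrite ext0_0 mul0r.
rewrite big_mkcond /=; apply: eq_bigr => u _.
rewrite inE trace_qrD trace_qr1 ext0_val /D_weight; case: ifP; rewrite ?mulr1 ?mulr0 //.
Qed.

Lemma corrE (phi psi : {unit F} -> algC) :
  corr r s phi psi = `|\sum_(u in D) phi u * (psi u)^*| / K.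
Proof.
have K0 : 0 <= K := ler0n _ _.
rewrite -[X in _ / X](ger0_norm K0) -normf_div mulr_suml /corr.
congr `|_|; apply: eq_bigr => u _.
have sK : (sqrtC K)^* = sqrtC K by rewrite conj_Creal // ger0_real // sqrtC_ge0.
by rewrite rmorphM fmorphV /= sK mulrACA -invfM -expr2 sqrtCK.
Qed.

Lemma corr_trivial_charE (phi : {unit F} -> algC) :
  corr r s phi (fun=> 1) = `|\sum_(u in D) phi u| / K.
Proof.
rewrite corrE; congr (`|_| / _); apply: eq_bigr => u _.
by rewrite rmorph1 mulr1.
Qed.

Lemma card_base_ge3 : (3 <= r)%N.
Proof. by have := card_base_pred; have := half_card_base_gt0; lia. Qed.

Lemma card_D_set_gt0 : 0 < K.
Proof.
rewrite card_D_set divr_gt0 ?mulr_gt0 ?ltr0n ?card_base_gt0 ?subr_gt0 ?ltr1n ?card_base_gt1 //.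
by rewrite card_field_base expn_gt0 card_base_gt0.
Qed.

Lemma irr_neq1 (i : Iirr G) : i != 0 -> exists u, 'chi_i u != 1.
Proof.
move=> i0; apply/existsP; rewrite -negb_forall; apply: contra i0 => /forallP one.
apply/eqP/irr_inj/cfunP => u; rewrite irr0 cfun1E inE.
exact/eqP.
Qed.

Lemma irr_corr_bound (i : Iirr G) : i != 0 ->
  (2%:R * (K * corr r s 'chi_i (fun=> 1))) ^+ 2 <=
  #|F|%:R / r%:R * (1 + sqrtC r%:R) ^+ 2.
Proof.
move=> /irr_neq1 i1; rewrite corr_trivial_charE.
have K0 := card_D_set_gt0; rewrite [K * _]mulrC divfK ?gt_eqF // sum_D_set; apply: char_sum_bound.
  exact/ext0_field_char/irr_mult_char.
exact: ext0_sum0 (irr_mult_char i) i1.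
Qed.

Lemma corr_ge0 (phi psi : {unit F} -> algC) : 0 <= corr r s phi psi.
Proof. exact: normr_ge0. Qed.

Lemma card_units : #|G| = N. Proof. exact: card_finField_unit. Qed.

(** The correlation of [phi] and [psi] is that of [phi * psi^*] with the trivial character, so the
    maximum over pairs is one over nontrivial irreducible characters. *)
Lemma Imax_irr : exists2 i : Iirr G, i != 0 &
  Imax_spec F r s (corr r s 'chi_i (fun=> 1)) /\
  forall j : Iirr G, j != 0 ->
    corr r s 'chi_j (fun=> 1) <= corr r s 'chi_i (fun=> 1).
Proof.
have [i0 i0n] : exists i : Iirr G, i != 0.
  have /card_gt1P [i [j [_ _ ij]]] : (1 < #|Iirr G|)%N.
    rewrite card_Iirr_abelian ?unit_abelian // card_units -ltnS prednK ?(ltnW (finNzRing_gt1 F)) //.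
    by rewrite card_field_base; apply: leq_trans card_base_ge3 _; rewrite -{1}[r]expn1 leq_exp2l ?card_base_gt1.
  have [i00|] := eqVneq i 0; last by exists i.
  by exists j; rewrite -i00 eq_sym.
(* [algC] is only partially ordered, so the maximum is taken among real values. *)
have rea : {in [pred i : Iirr G | i != 0], forall i,
    corr r s 'chi_i (fun=> 1) \is Num.real}.
  by move=> i _; apply/ger0_real/corr_ge0.
have [i in0 imax] := real_arg_maxP (P := [pred i : Iirr G | i != 0]) i0n rea.
exists i => //.
split=> //; split.
  exists 'chi_i, (fun=> 1); split=> //; [exact: irr_mult_char|exact: mult_char_triv|].
  exact: irr_neq1.
move=> phi psi phiP psiP [u uphi].
have [j jE] := mult_char_irr (mult_char_ratio phiP psiP).
rewrite [X in X <= _](_ : _ = corr r s 'chi_j (fun=> 1)).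
  apply: imax; apply: contraNneq uphi => j0; apply/eqP.
  have := jE u; rewrite j0 irr0 cfun1E inE /= => /(congr1 ( *%R^~ (psi u))).
  rewrite mul1r -mulrA [_^* * _]mulrC -normCK norm_mult_char // expr1n mulr1 => //.
rewrite corrE corr_trivial_charE; congr (`|_| / _); apply: eq_bigr => v _.
exact: jE.
Qed.

(** The squared sums over all characters total [N * K]; the trivial one contributes [K ^+ 2], and
    each of the other [N - 1] at most [(K * M) ^+ 2]. *)
Lemma welch_lower (M : algC) : 0 <= M ->
  (forall j : Iirr G, j != 0 -> corr r s 'chi_j (fun=> 1) <= M) ->
  N%:R * K - K ^+ 2 <= (N%:R - 1) * (K * M) ^+ 2.
Proof.
move=> M0 Mmax; have K0 := card_D_set_gt0.
rewrite -card_units -irr_sum_sqr (bigD1 0) //=.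
rewrite (_ : \sum_(u in D) 'chi_0 u = K); last first.
  rewrite -sum1_card natr_sum; apply: eq_bigr => u _.
  by rewrite irr0 cfun1E inE.
rewrite (ger0_norm (ltW K0)) addrC addrK.
apply: le_trans (_ : \sum_(i : Iirr G | i != 0) (K * M) ^+ 2 <= _).
  apply: ler_sum => i i0; rewrite ler_pXn2r ?nnegrE ?mulr_ge0 ?(ltW K0) //.
  have := Mmax i i0; rewrite corr_trivial_charE ler_pdivrMr //.
  by rewrite [M * _]mulrC.
have := sumr_const (Iirr G) ((K * M) ^+ 2); rewrite (bigD1 0) //=.
move=> /(canRL (addKr _)) ->; rewrite card_Iirr_abelian ?unit_abelian //.
by rewrite addrC mulrBl mul1r [#|G|%:R * _]mulr_natl.
Qed.

Lemma Imax_ratio_bounds : exists M : algC, Imax_spec F r s M /\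
  1 <= M / welch_bound F r s /\
  (M / welch_bound F r s) ^+ 2 <= (1 + sqrtC r%:R) ^+ 2 / (r%:R - 1).
Proof.
have [i i0 [Mspec Mmax]] := Imax_irr; have Mup := irr_corr_bound i0.
move: Mspec Mmax Mup; set M := corr _ _ _ _ => Mspec Mmax Mup.
have M0 : 0 <= M by apply: corr_ge0.
have Mlow := welch_lower M0 Mmax.
exists M; split=> //; rewrite /welch_bound subn1.
have K0 := card_D_set_gt0.
move: (K) (card_D_set) K0 Mup Mlow => k kE k0 Mup Mlow.
have NE : N%:R = #|F|%:R - 1 :> algC by rewrite -subn1 natrB // ltnW // finNzRing_gt1.
rewrite NE in Mlow *; apply: welch_ratio_estimate kE M0 _ Mlow Mup.
- by rewrite ler_nat card_base_ge3.
- by rewrite ler_nat card_field_base -{1}[r]expn1 leq_exp2l ?card_base_gt1.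
- by rewrite exprn_ge0 // addr_ge0 ?ler01 // sqrtC_ge0 ler0n.
Qed.

End Trace.

(** * Passage to the limit *)

Theorem mainTheorem2 :
  forall eps : algC, 0 < eps ->
  exists R : nat,
  forall p t s : nat,
    prime p -> odd p -> (0 < t)%N -> (0 < s)%N -> ~~ (p %| s)%N ->
    (R <= p ^ t)%N ->
    forall F : finFieldType, #|F| = (p ^ (t * s))%N ->
    exists M : algC,
      Imax_spec F (p ^ t) s M /\
      `| M / welch_bound F (p ^ t) s - 1 | < eps.
Proof.
(* With [x] the square root of r, the upper bound [(1 + x) ^+ 2 / (x ^+ 2 - 1)] equals
   [1 + 2 / (x - 1)], so [x > y] makes it smaller than [1 + eps]. *)
move=> eps eps0; pose y : algC := 1 + 2 / eps.
have e2 : 0 < 2 / eps by rewrite divr_gt0 ?ltr0n.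
have y0 : 0 < y by rewrite addr_gt0 ?ltr01.
exists (Num.bound (y ^+ 2)) => p t s p_pr p_odd t0 s0 ps Rr F cardF.
have [M [Mspec [rho1 rho2]]] := Imax_ratio_bounds p_pr t0 s0 cardF p_odd ps.
exists M; split=> //; move: rho1 rho2; set rho := M / _ => rho1 rho2.
rewrite ger0_norm ?subr_ge0 //.
move: rho2; set x := sqrtC _ => rho2.
have xx : (p ^ t)%:R = x ^+ 2 by rewrite sqrtCK.
have x0 : 0 <= x by rewrite sqrtC_ge0 ler0n.
have yx : y < x.
  rewrite -(@ltr_pXn2r _ 2) ?nnegrE ?(ltW y0) // -xx.
  apply: lt_le_trans (archi_boundP (exprn_ge0 2 (ltW y0))) _.
  by rewrite ler_nat.
have x1 : 2 / eps < x - 1 by rewrite ltrBrDl.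
have x1_gt0 : 0 < x - 1 := lt_trans e2 x1.
have xp : 0 < 1 + x by rewrite ltr_wpDr ?ltr01.
have rhoB : rho ^+ 2 <= 1 + 2 / (x - 1).
  apply: (le_trans rho2); rewrite xx le_eqVlt; apply/orP; left; apply/eqP.
  have -> : x ^+ 2 - 1 = (x - 1) * (1 + x) by ring.
  by field; rewrite ?(gt_eqF x1_gt0) ?(gt_eqF xp).
(* As [rho] is at least 1, bounding its square suffices. *)
have rho_sqr : rho <= rho ^+ 2.
  by rewrite expr2 ler_peMr // (le_trans ler01).
rewrite ltrBlDl; apply: le_lt_trans (le_trans rho_sqr rhoB) _.
rewrite ltrD2l ltr_pdivrMr // mulrC -ltr_pdivrMr //.
Qed.
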